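(* If $G$ and $H$ are finite groups such that $\mu(G\times H)\le 9$, then $\mu(G \times H) = \mu(G) + \mu(H)$.
   Context: For a finite group $G$, the minimal faithful permutation degree $\mu(G)$ is the least nonnegative integer $n$ such that $G$ embeds in the symmetric group $\mathrm{Sym}(n)$ (so $\mu$ of the trivial group is $0$). *)

(* Defs.v *)
From mathcomp Require Import all_boot all_fingroup.

Set Implicit Arguments.
Unset Strict Implicit.
Unset Printing Implicit Defensive.

Local Open Scope group_scope.

(* Boolean, so that ex_minn applies; embeds_in_symP is the form with an
   injective morphism. *)
Definition embeds_in_sym (gT : finGroupType) (G : {group gT}) (n : nat) : bool :=
  [exists K : {group 'S_n}, G \isog K].

Lemma embeds_in_symP (gT : finGroupType) (G : {group gT}) (n : nat) :
  reflect (exists f : {morphism G >-> 'S_n}, 'injm f) (embeds_in_sym G n).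
Proof.
apply: (iffP existsP) => [[K /isogP[f injf _]] | [f injf]]; first by exists f.
by exists (f @* G)%G; rewrite sub_isog.
Qed.

Definition cayley_fun (gT : finGroupType) (x : gT) (i : 'I_#|gT|) : 'I_#|gT| :=
  enum_rank (enum_val i * x).

Lemma cayley_fun_inj (gT : finGroupType) (x : gT) : injective (cayley_fun x).
Proof. by move=> i j /enum_rank_inj/mulIg/enum_val_inj. Qed.

Lemma ex_embeds_in_sym (gT : finGroupType) (G : {group gT}) :
  exists n, embeds_in_sym G n.
Proof.
pose cayley x := perm (@cayley_fun_inj gT x).
have cayleyM : {in G &, {morph cayley : x y / x * y}}.
  move=> x y _ _; apply/permP=> i.
  by rewrite permM !permE /cayley_fun enum_rankK mulgA.
exists #|gT|; apply/embeds_in_symP; exists (Morphism cayleyM).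
apply/injmP=> x y _ _ /= /permP/(_ (enum_rank 1)).
by rewrite !permE /cayley_fun enum_rankK !mul1g => /enum_rank_inj.
Qed.

(* The minimal faithful permutation degree of G. *)
Definition mu (gT : finGroupType) (G : {group gT}) : nat :=
  ex_minn (ex_embeds_in_sym G).

(* Main.v *)
Require Import Defs.
From mathcomp Require Import all_boot all_fingroup.
From mathcomp Require Import all_solvable zify.

(* Let D = G x H act faithfully on at most 9 points.  One orbit D / L at a time is traded,
   without increasing the degree, for a G-orbit and an H-orbit (possibly empty), while keeping
   the action faithful: if K is the kernel of the action on the other orbits, so that
   K :&: core L = 1, the new kernel must still meet K trivially.

   If L is an intersection of two larger subgroups of D, then D / L can be replaced by two
   smaller orbits, so L may be taken meet-irreducible.  If neither G nor H is transitive on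
   D / L, one G-orbit and one H-orbit have total size at most #|D : L|.  So let H be
   transitive; then G acts semiregularly.  If neither the action of G alone nor that of H
   alone suffices, then modulo core L there are nontrivial normal subgroups T <= G and
   T' <= H with T :&: T' = 1.  When G acts as a p-group, T contains a central M of order p,
   and meet-irreducibility forces the M-orbits into the orbits of any minimal normal
   M' <= T'.  With at most 9 points this leaves only degree 6, where D acts inside
   Z_2 wr S_3 = Z_2 x S_4 or Z_3 wr S_2 = Z_3 x S_3: the orbit splits as 2 + 4 or 3 + 3.
   When G acts as a group of order 6, G and H are both regular and it splits as 3 + 3. *)

Set Implicit Arguments.
Unset Strict Implicit.
Unset Printing Implicit Defensive.

Local Open Scope group_scope.

(** * Permutation representations with a prescribed kernel *)

(** The points form an arbitrary finite type and the degree is only bounded, so coset spaces and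
    disjoint unions serve as they are. *)
Definition perm_rep (gT : finGroupType) (G : {group gT}) (N : {set gT}) (n : nat) :=
  exists (T : finType) (f : {morphism G >-> {perm T}}), 'ker f = N /\ #|T| <= n.

Section PermRep.

Variable gT : finGroupType.
Implicit Types G H : {group gT}.

Lemma perm_rep_leq G N m n : m <= n -> perm_rep G N m -> perm_rep G N n.
Proof. by move=> le_mn [T [f [kerf leTm]]]; exists T, f; split; last exact: leq_trans le_mn. Qed.

Lemma perm_rep_normal G H n : perm_rep G H n -> H <| G.
Proof. by move=> [T [f [<- _]]]; apply: ker_normal. Qed.

Lemma perm_rep_triv G : perm_rep G G 0.
Proof.
by exists void, (trivm G); split; rewrite ?ker_trivm // card_void.
Qed.

Lemma perm_repI G M N m n :
  perm_rep G M m -> perm_rep G N n -> perm_rep G (M :&: N) (m + n).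
Proof.
move=> [S [f [<- leS]]] [T [g [<- leT]]].
pose h x (u : S + T) := match u with inl i => inl (f x i) | inr j => inr (g x j) end.
have h_inj x : injective (h x).
  by move=> [i|j] [i'|j'] //= [/perm_inj->].
have hM : {in G &, {morph (fun x => perm (@h_inj x)) : x y / x * y}}.
  move=> x y Gx Gy; apply/permP=> u.
  by rewrite permM !permE; case: u => [i|j] /=; rewrite morphM ?permM.
exists (S + T)%type, (Morphism hM); split; last by rewrite card_sum leq_add.
apply/setP=> x; rewrite !inE; case Gx: (x \in G) => //=.
apply/eqP/andP=> [/permP hx | [/eqP fx /eqP gx]].
  split; apply/eqP/permP=> i.
    by have:= hx (inl i); rewrite /= permE perm1 perm1 => -[].
  by have:= hx (inr i); rewrite /= permE perm1 perm1 => -[].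
by apply/permP=> u; rewrite /= permE perm1; case: u => [i|j] /=; rewrite ?fx ?gx perm1.
Qed.

Lemma perm_rep_gcore G H : H \subset G -> perm_rep G (gcore H G) #|G : H|.
Proof.
move=> sHG; pose S := rcosets H G.
have nSG : G \subset subact_dom (fun A : {set gT} => A \in S) 'Rs.
  rewrite /subact_dom; have/subset_trans->//: G \subset 'N(S | 'Rs).
    exact: atrans_acts (transRs_rcosets H G).
  apply/subsetP=> x; rewrite !inE => /subsetP nx.
  by apply/subsetP=> A; rewrite inE => /nx; rewrite !inE.
exists {A : {set gT} | A \in S}, (restrm nSG (actperm 'Rs^?)).
rewrite card_sig; split=> //.
rewrite ker_restrm ker_actperm astab_subact -astabRs_rcosets.
have ->: [set \val x | x in [set: {A : {set gT} | A \in S}]] = S.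
  apply/setP=> A; apply/imsetP/idP=> [[[B SB] _ ->] // | SA].
  by exists (exist _ A SA); rewrite ?inE.
rewrite setIA (setIidPl nSG); apply/setIidPr.
by rewrite astabRs_rcosets (subset_trans (gcore_sub H G)).
Qed.

Lemma perm_rep_mu G n : perm_rep G 1 n -> mu G <= n.
Proof.
move=> [T [f [kerf leTn]]]; apply: leq_trans leTn.
have inj_conj (s : {perm T}) : injective (fun i : 'I_#|T| => enum_rank (s (enum_val i))).
  by move=> i j /enum_rank_inj/perm_inj/enum_val_inj.
have cM : {in G &, {morph (fun x => perm (inj_conj (f x))) : x y / x * y}}.
  move=> x y Gx Gy; apply/permP=> i.
  by rewrite permM !permE enum_rankK morphM // permM.
rewrite /mu; case: ex_minnP => d _; apply.
apply/embeds_in_symP; exists (Morphism cM); apply/subsetP=> x.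
rewrite !inE => /andP[Gx /eqP/permP cx]; rewrite -in_set1 -[[set 1]]kerf !inE Gx.
apply/eqP/permP=> u; have:= cx (enum_rank u).
by rewrite /= permE enum_rankK !perm1 => /enum_rank_inj.
Qed.

Lemma mu_perm_rep G : perm_rep G 1 (mu G).
Proof.
rewrite /mu; case: ex_minnP => n /embeds_in_symP[f injf] _.
exists 'I_n, f; split; last by rewrite card_ord.
exact/trivgP.
Qed.

End PermRep.

Lemma perm_rep_sub (gT : finGroupType) (D H : {group gT}) (N : {set gT}) n :
  H \subset D -> perm_rep D N n -> perm_rep H (H :&: N) n.
Proof.
by move=> sHD [T [f [<- leT]]]; exists T, (restrm sHD f); rewrite ker_restrm.
Qed.

Lemma perm_rep_morphpre (aT rT : finGroupType) (E D : {group aT}) (R : {group rT})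
    (g : {morphism E >-> rT}) (N : {set rT}) n :
  D \subset E -> g @* D \subset R -> perm_rep R N n -> perm_rep D (D :&: g @*^-1 N) n.
Proof.
move=> sDE sgR [T [f [<- leTn]]].
have sD : D \subset 'dom (f \o g) by rewrite /= -sub_morphim_pre.
by exists T, (restrm sD (f \o g)); rewrite ker_restrm ker_comp.
Qed.

Lemma perm_rep_quotient (gT : finGroupType) (G H C : {group gT}) (N : {set coset_of C}) n :
    G \subset H -> H \subset 'N(C) -> perm_rep (H / C) N n ->
  perm_rep G (G :&: coset C @*^-1 N) n.
Proof.
by move=> sGH nCH; apply: perm_rep_morphpre; [apply: subset_trans nCH | apply: quotientS].
Qed.

(** * Groups of small order *)

Section SmallOrders.
Variable gT : finGroupType.
Implicit Types G H : {group gT}.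

Lemma perm_rep_dvd_fact G (N : {set gT}) n : perm_rep G N n -> #|G : N| %| n`!.
Proof.
move=> [T [f [<- leTn]]].
rewrite -[X in #|X : _|]setIid -card_morphim (dvdn_trans (cardSg (subsetT _))) //.
rewrite (_ : #|_| = #|T|`!); last by rewrite -card_Sym; apply: eq_card => s; rewrite !inE.
by rewrite -(subKn leTn) -(ffact_fact (leq_subr #|T| n)) dvdn_mull.
Qed.

Lemma Sylow_index_dvd (rT : finGroupType) (G P : {group rT}) p a m :
  prime p -> p.-Sylow(G) P -> #|G| %| p ^ a * m -> #|G : P| %| m.
Proof.
move=> p_pr sylP; rewrite -(Lagrange (pHall_sub sylP)) => /(dvdn_trans (dvdn_mull _ (dvdnn _))).
rewrite Gauss_dvdr // coprimeXr // coprime_sym prime_coprime // -p'natE //.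
by case/and3P: sylP.
Qed.

(** A Sylow 3-subgroup has index at most 2, hence is normal. *)
Lemma solvable_dvd6 (rT : finGroupType) (G : {group rT}) : #|G| %| 6 -> solvable G.
Proof.
move=> G6; have [P sylP] := Sylow_exists 3 G.
have iP : #|G : P| %| 2 by apply: (@Sylow_index_dvd _ G P 3 1).
have nPG : P <| G.
  have sPG := pHall_sub sylP.
  move: iP; rewrite dvdn_divisors // !inE => /orP[/eqP/index1g-> // | /eqP]; exact: index2_normal.
rewrite (series_sol nPG) (pgroup_sol (pHall_pgroup sylP)) /=.
apply/abelian_sol/cyclic_abelian/(@dvdn_prime_cyclic _ _ 2) => //.
by rewrite card_quotient // normal_norm.
Qed.

(** The core of a Sylow 2-subgroup is a 2-group, and its quotient acts faithfully on at most 3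
    cosets, so has order dividing 6. *)
Lemma solvable_dvd24 G : #|G| %| 24 -> solvable G.
Proof.
move=> G24; have [P sylP] := Sylow_exists 2 G.
have iP : #|G : P| %| 3 by apply: (@Sylow_index_dvd _ G P 2 3).
have sPG := pHall_sub sylP; have nN := gcore_normal sPG.
have sNP := gcore_sub P G.
rewrite (series_sol nN) (pgroup_sol (pgroupS sNP (pHall_pgroup sylP))) /=.
have [iP1|iP3]: #|G : P| = 1%N \/ #|G : P| = 3.
  by move: iP; rewrite dvdn_divisors // !inE => /orP[] /eqP; [left | right].
  have := perm_rep_dvd_fact (perm_rep_gcore sPG); rewrite iP1 -card_quotient ?normal_norm // => d1.
  exact: solvable_dvd6 (dvdn_trans d1 (dvd1n 6)).
have := perm_rep_dvd_fact (perm_rep_gcore sPG); rewrite iP3 -card_quotient ?normal_norm //.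
exact: solvable_dvd6.
Qed.

(** A Sylow 3-subgroup is normal and nontrivial, so the hypothesis kills the core of a Sylow
    2-subgroup, whose three cosets then carry a faithful action. *)
Lemma perm_rep3_card6 G :
  (forall R S : {group gT}, R <| G -> S <| G -> R :&: S = 1 -> R :=: 1 \/ S :=: 1) ->
  #|G| = 6 -> perm_rep G 1 3.
Proof.
move=> irrG oG.
have [P sylP] := Sylow_exists 2 G; have [Q sylQ] := Sylow_exists 3 G.
have [sPG sQG] := (pHall_sub sylP, pHall_sub sylQ).
have iP : #|G : P| = 3.
  by have := Lagrange sPG; rewrite (card_Hall sylP) oG p_part /= => /eqP;
    rewrite (eqn_mul2l 2 _ 3) => /eqP.
have iQ : #|G : Q| = 2.
  by have := Lagrange sQG; rewrite (card_Hall sylQ) oG p_part /= => /eqP;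
    rewrite (eqn_mul2l 3 _ 2) => /eqP.
have tiPQ : gcore P G :&: Q = 1.
  apply: coprime_TIg; rewrite (card_Hall sylQ) oG p_part /=.
  apply: (coprime_dvdl (cardSg (gcore_sub P G))).
  by rewrite (card_Hall sylP) oG p_part.
have := perm_rep_gcore sPG; rewrite iP.
have [-> // | Q1] := irrG _ Q (gcore_normal sPG) (index2_normal sQG iQ) tiPQ.
by move: iQ; rewrite Q1 indexg1 oG.
Qed.

Lemma normal_card2_central G H : H <| G -> #|H| = 2 -> H \subset 'Z(G).
Proof.
move=> /andP[sHG nHG] oH; rewrite subsetI sHG; apply/centsP=> x Hx g Gg.
have [-> | ntx] := eqVneq x 1; first exact/commute_sym/commute1.
have := cardsD1 1 H; rewrite group1 oH => -[] /esym/eqP/cards1P[y defH].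
have eq_y u : u \in H -> u != 1 -> u = y.
  by move=> Hu ntu; apply/set1P; rewrite -defH !inE ntu.
apply/commgP/conjg_fixP; rewrite (eq_y x) // (eq_y (y ^ g)) //.
  by rewrite memJ_norm ?(subsetP nHG) // -(eq_y x).
by rewrite conjg_eq1 -(eq_y x).
Qed.

End SmallOrders.

(** * A central subgroup of prime order against a minimal normal subgroup *)

(** Used with [m = #|D : L|], [s = #|M' : L|] the size of an [M']-orbit, and [i = #|D : LM'|] the
    number of these orbits. Bounding [p], [i] and [r = s / p] leaves finitely many cases; only
    [(p, i) = (2, 3)] and [(3, 2)] with [r = 1] survive. *)
Lemma index_eq6 p s i m :
  prime p -> (s * i = m)%N -> m <= 9 -> 0 < s -> 1 < i -> p %| s ->
  (p.-nat m -> p * p <= s) -> (p = 2 -> s = 4 -> i = 2 -> False) ->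
  [/\ m = 6, s = p & p = 2 \/ p = 3].
Proof.
move=> p_pr <- le9 s_gt0 i_gt1 /dvdnP[r Es]; rewrite {s}Es in le9 s_gt0 *.
have [r_gt0 p_gt0] : 0 < r /\ 0 < p by apply/andP; rewrite -muln_gt0.
have p_gt1 := prime_gt1 p_pr.
have p_lt5 : p < 5 by nia.
have i_lt5 : i < 5 by nia.
have r_lt3 : r < 3 by nia.
case: p p_pr p_gt0 p_gt1 p_lt5 le9 s_gt0 => [|[|[|[|[|]]]]] // _ _ _ _;
  case: i i_gt1 i_lt5 => [|[|[|[|[|]]]]] // _ _;
  case: r r_gt0 r_lt3 => [|[|[|]]] // _ _ _ _ /= sq no;
  try by [have := sq isT | case: (no erefl erefl erefl)].
- by split; [| | left].
- by split; [| | right].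
Qed.

(* [D] acts faithfully on the cosets of [L], [M] is central of prime order and [M'] is another
   minimal normal subgroup, whose orbits contain those of [M]. *)
Section CentralVersusMinimal.

Variables (gT : finGroupType) (D L M M' : {group gT}) (p : nat).
Hypotheses (sLD : L \subset D)
  (coreL : forall N : {group gT}, N <| D -> N \subset L -> N :=: 1)
  (p_pr : prime p) (oM : #|M| = p) (sMZ : M \subset 'Z(D))
  (minM' : minnormal M' D) (sM'D : M' \subset D) (tiMM' : M :&: M' = 1)
  (sLMM' : L * M \subset L * M') (le_iL : #|D : L| <= 9).

Let LM := (L <*> M)%G.
Let LM' := (L <*> M')%G.
Let N := gcore_group LM D.

Let sMD : M \subset D := subset_trans sMZ (center_sub D).
Let cDM : D \subset 'C(M).
Proof. by rewrite centsC (subset_trans sMZ) ?subsetIr. Qed.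
Let nDM : D \subset 'N(M) := cents_norm cDM.
Let nMD : M <| D. Proof. by rewrite /normal sMD. Qed.
Let nDM' : D \subset 'N(M').
Proof. by case/mingroupP: minM' => /andP[]. Qed.
Let nM'D : M' <| D. Proof. by rewrite /normal sM'D. Qed.
Let ntM' : M' :!=: 1.
Proof. by case/mingroupP: minM' => /andP[]. Qed.

Let defLM : LM :=: L * M.
Proof. exact: norm_joinEl (subset_trans sLD nDM). Qed.
Let defLM' : LM' :=: L * M'.
Proof. exact: norm_joinEl (subset_trans sLD nDM'). Qed.
Let sLMD : LM \subset D. Proof. by rewrite join_subG sLD. Qed.
Let sLM'D : LM' \subset D. Proof. by rewrite join_subG sLD. Qed.
Let sLMLM' : LM \subset LM'. Proof. by rewrite defLM defLM'. Qed.
Let sNLM : N \subset LM := gcore_sub LM D.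
Let nND : N <| D := gcore_normal sLMD.

Let minM'E (K : {group gT}) : K <| D -> K \subset M' -> K :=: 1 \/ K :=: M'.
Proof.
move=> /andP[_ nKD] sKM'; have [-> | ntK] := eqVneq (K : {set gT}) 1; first by left.
by right; case/mingroupP: minM' => _; apply=> //; rewrite ntK.
Qed.

Let tiLM : L :&: M = 1.
Proof.
apply: (coreL (N := (L :&: M)%G)); last exact: subsetIl.
by apply: sub_center_normal; rewrite (subset_trans (subsetIr _ _)).
Qed.

Let oLM : #|LM| = (#|L| * p)%N.
Proof. by rewrite defLM TI_cardMg ?oM. Qed.

Let p_gt0 : 0 < p := prime_gt0 p_pr.
Let p_gt1 : 1 < p := prime_gt1 p_pr.

Let iLM : (p * #|D : LM|)%N = #|D : L|.
Proof.
apply/eqP; rewrite -(eqn_pmul2l (cardG_gt0 L)) Lagrange // mulnA -oLM.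
by rewrite Lagrange.
Qed.

(** [LM / L] is cyclic, being an image of [M], so the derived subgroup of [N] lies in [L]; it is
    normal in [D], hence trivial. *)
Let abN : abelian N.
Proof.
have nLLM : L <| LM.
  by rewrite /normal joing_subl join_subG normG cents_norm // centsC (subset_trans sLD cDM).
have sderL : LM^`(1) \subset L.
  apply: der1_min (normal_norm nLLM) _; rewrite /= quotientYidl ?(normal_norm nLLM) //.
    by apply/quotient_abelian/cyclic_abelian/prime_cyclic; rewrite oM.
  by rewrite (subset_trans _ (normal_norm nLLM)) ?joing_subr.
rewrite /abelian; apply/commG1P; apply: (coreL (N := N^`(1)%G)).
  exact: char_normal_trans (der_char 1 N) nND.
exact: subset_trans (dergS 1 sNLM) sderL.
Qed.

(** Solvability suffices. Either [M'] lies in the abelian group [N], or it embeds in [D / N], which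
    acts faithfully on the at most 4 cosets of [LM]. *)
Let abelM' : is_abelem M'.
Proof.
suffices solM': solvable M' by case: (minnormal_solvable minM' (subxx _) solM').
have [tiN | defM'] := minM'E (normalI nND nM'D) (subsetIr _ _); last first.
  by rewrite abelian_sol // (abelianS _ abN) // -defM' subsetIl.
have nNM' : M' \subset 'N(N) := subset_trans sM'D (normal_norm nND).
apply: solvable_dvd24; rewrite (card_isog (quotient_isog nNM' tiN)).
apply: dvdn_trans (cardSg (quotientS N sM'D)) _.
rewrite card_quotient ?normal_norm //.
apply: dvdn_trans (perm_rep_dvd_fact (perm_rep_gcore sLMD)) _.
have : #|D : LM| <= 4.
  rewrite -ltnS -(ltn_pmul2l p_gt0) iLM (leq_ltn_trans le_iL) //.
  exact: leq_trans (leq_mul p_gt1 (leqnn 5)).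
by case: #|_ : _| => [|[|[|[|[|n]]]]].
Qed.

Let oLM' : #|LM'| = (#|L| * #|M' : L|)%N.
Proof. by rewrite defLM' normC ?(subset_trans sLD) // -LagrangeMr mulnC. Qed.

Let dvd_p_s : p %| #|M' : L|.
Proof. by rewrite -(dvdn_pmul2l (cardG_gt0 L)) -oLM' -oLM cardSg. Qed.

Let pM' : p.-group M'.
Proof.
have qM' := abelem_pgroup abelM'.
suffices /eqP-> : p == pdiv #|M'| by [].
have: (pdiv #|M'|).-nat p.
  by apply: pnat_dvd qM'; rewrite (dvdn_trans dvd_p_s) ?dvdn_indexg.
by rewrite pnatE // inE eq_sym.
Qed.

Let abM' : abelian M'. Proof. exact: abelem_abelian abelM'. Qed.

Let iLM' : (#|M' : L| * #|D : LM'|)%N = #|D : L|.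
Proof.
apply/eqP; rewrite -(eqn_pmul2l (cardG_gt0 L)) Lagrange // mulnA -oLM'.
by rewrite Lagrange.
Qed.

Let E := (M <*> M')%G.
Let defE : E :=: M * M'.
Proof. exact: norm_joinEr (subset_trans sM'D nDM). Qed.
Let oE : #|E| = (p * #|M'|)%N.
Proof. by rewrite defE TI_cardMg ?oM. Qed.
Let sED : E \subset D. Proof. by rewrite join_subG sMD. Qed.
Let nDE : D \subset 'N(E). Proof. exact: normsY. Qed.
Let abE : abelian E.
Proof.
by rewrite abelianY (abelianS sMZ (center_abelian D)) abM' (subset_trans sM'D).
Qed.

(* Otherwise [L * M * M'] would have order [#|L| * p * #|M'|], too large for [L * M']. *)
Let ntEL : E :&: L != 1.
Proof.
apply/negP=> /eqP tiEL.
have: #|L * E| <= #|L * M'|.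
  rewrite subset_leq_card // defE mulgA (subset_trans (mulSg M' sLMM')) //.
  by rewrite -mulgA mulGid.
rewrite TI_cardMg 1?setIC // oE; apply/negP; rewrite -ltnNge.
rewrite mulnCA (@leq_ltn_trans (#|L| * #|M'|)) ?ltn_Pmull ?muln_gt0 ?cardG_gt0 //.
by rewrite mul_cardG leq_pmulr ?cardG_gt0.
Qed.

Let EL_not_normal : ~~ (D \subset 'N(E :&: L)).
Proof.
apply: contra ntEL => nDEL; apply/eqP/(coreL (N := (E :&: L)%G)); last exact: subsetIr.
by rewrite /normal subIset ?sED.
Qed.

(** If [M'] were transitive, [D = L * M'] would normalise [E :&: L]: [L] normalises both terms, and
    [M'] lies in the abelian group [E]. *)
Let ltLM'D : 1 < #|D : LM'|.
Proof.
rewrite indexg_gt1; apply: contra EL_not_normal => sDLM'.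
apply: subset_trans sDLM' _; rewrite defLM' mul_subG //.
  by rewrite normsI ?normG // (subset_trans sLD).
apply: cents_norm; rewrite (centsS (subsetIl E L)) //.
by rewrite (subset_trans _ abE) ?joing_subr.
Qed.

Let M'_not_central : ~~ (M' \subset 'Z(D)).
Proof.
apply: contra EL_not_normal => sM'Z.
have sEZ : E \subset 'Z(D) by rewrite join_subG sMZ.
rewrite cents_norm // centsC (subset_trans (subsetIl _ _)) // (subset_trans sEZ) //.
exact: subsetIr.
Qed.

Let M'_card_gt2 : 2 < #|M'|.
Proof.
have := M'_not_central; have: 1 < #|M'| by rewrite cardG_gt1.
rewrite leq_eqVlt => /orP[/eqP oM' | //].
by rewrite normal_card2_central.
Qed.

(* A Sylow [p]-subgroup [P] of [D] is transitive on [D / L], so the points fixed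
   by an element of [M' :&: 'Z(P)] form a [P]-invariant set; hence
   [M * (M' :&: 'Z(P))] acts semiregularly. *)
Let p2_leq_s : p.-nat #|D : L| -> p * p <= #|M' : L|.
Proof.
move=> pD; have [P sylP] := Sylow_exists p D.
have sPD := pHall_sub sylP.
have defD : L * P = D.
  apply: coprime_index_mulG => //; rewrite (pnat_coprime pD) //.
  by case/and3P: sylP.
pose W := (M' :&: 'Z(P))%G.
have nM'P : M' <| P.
  apply: normalS nM'D => //; apply: subset_trans (pcore_max pM' nM'D) _.
  exact: pcore_sub_Hall sylP.
have ntW : W :!=: 1 by apply: meet_center_nil (pgroup_nil (pHall_pgroup sylP)) nM'P ntM'.
have pW : p <= #|W|.
  have/pgroupP pW : p.-group W := pgroupS (subsetIl _ _) pM'.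
  have := pdiv_dvd #|W|; have: prime (pdiv #|W|) by rewrite pdiv_prime // cardG_gt1.
  by move=> pr_q /[dup] /(pW _ pr_q); rewrite inE => /eqP-> /dvdn_leq->.
have tiMW : M :&: W = 1.
  by apply/trivgP; rewrite -tiMM' setIS ?subsetIl.
have defMW : M <*> W = M * W by rewrite norm_joinEr // (subset_trans _ nDM) // subIset ?sM'D.
pose B := (L :&: (M <*> W))%G.
have cPB : P \subset 'C(B).
  rewrite centsC (subset_trans (subsetIr _ _)) // join_subG subIset ?subsetIr ?orbT // andbT.
  by rewrite centsC (subset_trans sPD).
have tiLMW : B :=: 1.
  apply/trivgP; rewrite -(coreL (gcore_normal sLD) (gcore_sub L D)).
  (* For [d = x * y] with [x] in [L] and [y] in [P], [L :^ d = L :^ y] contains [B :^ y = B]; so [B]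
     lies in the core of [L]. *)
  apply/bigcapsP=> d; rewrite -defD => /mulsgP[x y Lx Py ->].
  rewrite conjsgM (conjGid Lx) -(normP (subsetP (cents_norm cPB) _ Py)).
  by rewrite conjSg subsetIl.
have: #|L * (M <*> W)| <= #|LM'|.
  rewrite subset_leq_card // defMW mulgA defLM' (subset_trans (mulSg W sLMM')) //.
  by rewrite -mulgA mulgS // mul_subG ?subsetIl.
have oMW : #|M <*> W| = (p * #|W|)%N by rewrite defMW TI_cardMg ?oM.
rewrite (TI_cardMg tiLMW) oLM' leq_pmul2l //; apply: leq_trans.
by apply: leq_trans (eq_leq (esym oMW)); rewrite leq_pmul2l.
Qed.

(** [V] has index 2 in [M'] and is normal in [LM']. For [d] outside [LM'], conjugation by [d] swaps
    [V] and [V :^ d], so their intersection is normal in [D], hence trivial by minimality of [M'];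
    this forces [#|V| = 2]. Both conjugates are then central in [LM'], and [v * v ^ d] is a
    nontrivial element of [M'] central in [D], so [M'] would be central. *)
Let index2_absurd : p = 2 -> #|M' : L| = 4 -> #|D : LM'| = 2 -> False.
Proof.
move=> p2 s4 iU2; pose V := (M' :&: LM)%G.
have oV : #|M'| = (2 * #|V|)%N.
  have defU : LM * M' = LM'.
    apply/eqP; rewrite eqEsubset mul_subG ?joing_subr //=.
    by rewrite defLM' mulSg ?joing_subl.
  have := mul_cardG LM M'; rewrite defU oLM oLM' p2 s4 setIC -!mulnA => /eqP.
  by rewrite eqn_pmul2l // -[4]/(2 * 2)%N -mulnA eqn_pmul2l // => /eqP.
have nUD : LM' <| D by apply: index2_normal.
have nVU : V <| LM'.
  apply: normalI; first by apply: normalS nM'D; rewrite ?joing_subr.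
  apply: index2_normal => //; apply/eqP.
  by rewrite -(eqn_pmul2l (cardG_gt0 LM)) Lagrange // oLM oLM' p2 s4 -mulnA.
have [d Dd U'd] : exists2 d, d \in D & d \notin LM'.
  by apply/subsetPn; rewrite -indexg_gt1.
have defD : LM' <*> <[d]> = D.
  rewrite norm_joinEr ?cycle_subG ?(subsetP (normal_norm nUD)) //.
  apply: mulg_normal_maximal => //; rewrite ?cycle_subG //.
  by apply: p_index_maximal; rewrite ?iU2.
have d2 : d * d = d ^+ 2 by rewrite expgS expg1.
have Ud2 : d ^+ 2 \in LM'.
  have nUd : d \in 'N(LM') by rewrite (subsetP (normal_norm nUD)).
  apply: coset_idr; rewrite ?groupX // morphX //.
  have := expg_cardG (mem_quotient LM' Dd).
  by rewrite card_quotient ?normal_norm // iU2.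
have nUVd : V :^ d <| LM'.
  by rewrite -(normP (subsetP (normal_norm nUD) _ Dd)) normalJ.
have sVdM' : V :^ d \subset M'.
  by rewrite -(normP (subsetP nDM' _ Dd)) conjSg subsetIl.
have Vd2 : V :^ (d ^+ 2) = V by apply/normP; apply: subsetP Ud2; case/andP: nVU.
have tiVVd : V :&: V :^ d = 1.
  have nIU := normalI nVU nUVd.
  have nID : V :&: V :^ d <| D.
    rewrite /normal (subset_trans (subsetIl _ _)) /=; last exact: subset_trans (subsetIl _ _) sM'D.
    rewrite -defD join_subG cycle_subG (normal_norm nIU) /=.
    by apply/normP; rewrite conjIg -conjsgM d2 Vd2 setIC.
  case: (@minM'E (V :&: V :^ d)%G) => //.
    by rewrite (subset_trans (subsetIl _ _)) ?subsetIl.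
  move=> defM'; have: #|M'| <= #|V| by rewrite -defM' subset_leq_card ?subsetIl.
  by rewrite oV leqNgt ltn_Pmull ?cardG_gt0.
have oV2 : #|V| = 2.
  have: #|V * V :^ d| <= #|M'| by rewrite subset_leq_card ?mul_subG ?subsetIl.
  rewrite (TI_cardMg (H := (V :^ d)%G)) // cardJg oV leq_pmul2r // => leV.
  have: 4 <= #|M'| by rewrite -s4 dvdn_leq ?dvdn_indexg.
  by rewrite oV -[4]/(2 * 2)%N leq_pmul2l // => ltV; apply/eqP; rewrite eqn_leq leV.
have cVU : LM' \subset 'C(V).
  by rewrite centsC (subset_trans (normal_card2_central nVU oV2)) ?subsetIr.
have cVdU : LM' \subset 'C(V :^ d).
  rewrite centsC (subset_trans (normal_card2_central (H := (V :^ d)%G) nUVd _)) ?subsetIr //.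
  by rewrite cardJg.
have [v Vv ntv] : exists2 v, v \in V & v != 1.
  by apply/trivgPn; rewrite -cardG_gt1 oV2.
have Vdvd : v ^ d \in V :^ d by rewrite memJ_conjg.
have [M'v M'vd] : v \in M' /\ v ^ d \in M'.
  by split; [case/setIP: Vv | apply: subsetP Vdvd].
pose w := v * v ^ d.
have ntw : w != 1.
  apply: contra ntv; rewrite -eq_invg_mul => /eqP defvd.
  by rewrite -in_set1 -[[set 1]]tiVVd inE Vv -groupV defvd.
have Zw : w \in 'Z(D).
  rewrite inE groupM ?(subsetP sM'D) //= -sub_cent1 -defD join_subG cycle_subG.
  apply/andP; split.
    rewrite sub_cent1 groupM //.
      by apply: subsetP Vv; rewrite centsC.
    by apply: subsetP Vdvd; rewrite centsC.
  apply/cent1P; apply: commute_sym; apply/commgP/conjg_fixP.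
  rewrite conjMg -conjgM d2 (_ : v ^ (d ^+ 2) = v).
    by apply: (centsP abM').
  by apply/conjg_fixP/commgP/commute_sym; apply: (centsP cVU).
case/negP: M'_not_central.
have nwD : <[w]> <| D by apply: sub_center_normal; rewrite cycle_subG.
have swM' : <[w]> \subset M' by rewrite cycle_subG groupM.
have [/eqP | <-] := minM'E nwD swM'; last by rewrite cycle_subG.
by rewrite cycle_eq1 (negPf ntw).
Qed.

Lemma central_index6 : [/\ #|D : L| = 6, #|M' : L| = p & p = 2 \/ p = 3].
Proof.
exact: index_eq6 p_pr iLM' le_iL (indexg_gt0 M' L) ltLM'D dvd_p_s p2_leq_s index2_absurd.
Qed.

(** * Degree 6: the structure of [D / M] *)

Let t := #|D : LM|.

Let pt6 : (p * t)%N = 6.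
Proof. by rewrite iLM; case: central_index6. Qed.

Let t_def : t = (6 %/ p)%N. Proof. by rewrite -pt6 mulKn. Qed.

Let t_pr : prime t.
Proof.
by rewrite t_def; case: central_index6 => _ _ [] ->.
Qed.

(** [LM] has prime index, hence is maximal, and it normalises the non-normal subgroup [E :&: L], so
    it is the whole normaliser. The centraliser of [M'] centralises [E], hence lies in [LM]; being
    normal in [D], it lies in the core. *)
Let sCM'N : 'C_D(M') \subset N.
Proof.
have maxLM : maximal LM D by apply: p_index_maximal.
have sLMn : LM \subset 'N_D(E :&: L).
  rewrite subsetI sLMD join_subG normsI ?normG ?(subset_trans sLD nDE) //=.
  by rewrite cents_norm // centsC (subset_trans (subset_trans (subsetIl _ _) sED) cDM).
have defn : 'N_D(E :&: L) = LM.
  case/maxgroupP: maxLM => _; apply; rewrite // properE subsetIl /=.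
  by apply: contra EL_not_normal => sDn; rewrite (subset_trans sDn) ?subsetIr.
apply: gcore_max; last by rewrite normsI ?normG // norms_cent.
rewrite -defn subsetI subsetIl cents_norm //= centsC (subset_trans (subsetIl E L)) //.
by rewrite join_subG !(centsC _ 'C_D(M')) subsetIr subIset ?cDM.
Qed.

Let sEN : E \subset N.
Proof.
apply: subset_trans sCM'N; rewrite subsetI sED (subset_trans (abE : E \subset 'C(E))) //.
by rewrite centS ?joing_subr.
Qed.

(** Intersecting a subgroup of [N] with a conjugate of [L] divides its order by at most [p], as
    [#|LM| = #|L| * p]. Since [LM] normalises [L], one conjugate for each of the [t] cosets of [LM]
    is enough to reach the trivial core. *)
Let leN : #|N| <= p ^ t.
Proof.
have step (A : {group gT}) d : A \subset N -> d \in D -> #|A| <= #|A :&: L :^ d| * p.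
  move=> sAN Dd; rewrite -(leq_pmul2r (cardG_gt0 L)) -{1}(cardJg L d).
  rewrite (mul_cardG A (L :^ d)%G) mulnC -mulnA leq_mul2l (mulnC p) -oLM -(cardJg LM d).
  rewrite subset_leq_card ?orbT // mul_subG ?conjSg ?joing_subl // (subset_trans sAN) //.
  by rewrite -(normP (subsetP (normal_norm nND) _ Dd)) conjSg.
pose K s := foldr (fun d A => A :&: L :^ d)%G N s.
have sKN s : K s \subset N by elim: s => //= d s IHs; rewrite subIset ?IHs.
have bound s : {subset s <= D} -> #|N| <= #|K s| * p ^ size s.
  elim: s => [|d s IHs] sD; first by rewrite muln1.
  apply: leq_trans (IHs _) _; first by move=> x sx; rewrite sD // inE sx orbT.
  rewrite expnS mulnA leq_mul2r; apply/orP; right.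
  by apply: step; rewrite ?sKN ?sD ?mem_head.
have sKL s d : d \in s -> K s \subset L :^ d.
  elim: s => //= e s IHs; rewrite inE => /predU1P[-> | /IHs sKd]; first exact: subsetIr.
  by rewrite subIset ?sKd.
pose s := [seq repr A | A <- enum (rcosets LM D)].
have sz : size s = t by rewrite size_map -cardE.
have mem_coset x : x \in D -> exists2 l, l \in LM & repr (LM :* x) = l * x.
  by move=> _; apply/rcosetP; rewrite mem_repr_rcoset.
have sD : {subset s <= D}.
  move=> _ /mapP[A + ->]; rewrite mem_enum => /rcosetsP[x Dx ->].
  by have [l LMl ->] := mem_coset x Dx; rewrite groupM // (subsetP sLMD).
apply: leq_trans (bound s sD) _; rewrite sz -[X in _ <= X]mul1n leq_mul2r.
rewrite -(cards1 (1 : gT)) subset_leq_card ?orbT //.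
apply: (@subset_trans _ _ (gcore L D)); last by rewrite (coreL (gcore_normal sLD) (gcore_sub L D)).
apply/bigcapsP=> x Dx; have [l LMl def_rep] := mem_coset x Dx.
have nLl : L :^ l = L.
  apply/normP; apply: subsetP LMl; rewrite join_subG normG cents_norm // centsC.
  exact: subset_trans sLD cDM.
rewrite -nLl -conjsgM -def_rep sKL //.
by rewrite map_f // mem_enum; apply/rcosetsP; exists x.
Qed.

(** [M'] is a [p]-group with more than 2 elements, so [#|E| = p * #|M'|] is at least 8 for [p = 2]
    and at least 9 for [p = 3]; in both cases this is the bound [p ^ t]. *)
Let defN : N :=: E.
Proof.
apply/esym/eqP; rewrite eqEcard sEN (leq_trans leN) // oE.
have := M'_card_gt2; have [k ->] := p_natP pM'; rewrite -expnS leq_exp2l // t_def.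
by case: central_index6 => _ _ [] ->; case: k => [|[|k]].
Qed.

Let pN : p.-group N.
Proof. by rewrite /pgroup defN oE pnatM pnat_id // -/(pgroup _ _) pM'. Qed.

Let card_quo : #|D / M| %| t`! * p ^ t.-1.
Proof.
have sMN : M \subset N by rewrite defN joing_subl.
rewrite card_quotient // -(Lagrange_index (normal_sub nND) sMN).
apply: dvdn_mul (perm_rep_dvd_fact (perm_rep_gcore sLMD)) _.
have := leN; have := Lagrange sMN; rewrite oM; have [k ->] := p_natP pN.
move=> def_k; rewrite leq_exp2l // => le_kt.
have: p * #|N : M| %| p * p ^ t.-1.
  by rewrite def_k -expnS (prednK (prime_gt0 t_pr)) dvdn_exp2l.
by rewrite dvdn_pmul2l.
Qed.

(** [[~: K, M']] lies in both [M] and [M'], so [K] already centralises [M'] itself. *)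
Let centralizer_quo (K : {group gT}) :
  K \subset D -> K / M \subset 'C(M' / M) -> K \subset N.
Proof.
move=> sKD; rewrite quotient_cents2 ?(subset_trans _ nDM) // => cKM'.
apply: subset_trans sCM'N; rewrite subsetI sKD; apply/commG1P/trivgP.
rewrite -tiMM' subsetI cKM' commg_subr.
exact: subset_trans sKD nDM'.
Qed.

(* [D / M] acts on its Sylow [t]-subgroups, of which there are at most [6 - p]; the action is
   faithful because [M' / M] is self-centralising. *)
Lemma perm_rep_central : perm_rep D M (6 - p).
Proof.
have [S sylS] := Sylow_exists t D; have sSD := pHall_sub sylS.
have sylSM : t.-Sylow(D / M) (S / M) by rewrite quotient_pHall // (subset_trans sSD).
pose n := #|D / M : 'N_(D / M)(S / M)|.
have le_n : n <= 6 - p.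
  (* By Sylow, [n] is 1 modulo [t]. For [p = 2] it divides 24, so is 1 or 4; for [p = 3] it divides
     6, so is 1 or 3. *)
  have : n %| t`! * p ^ t.-1 by rewrite (dvdn_trans _ card_quo) ?dvdn_indexg.
  have : n %% t = 1%N by rewrite /n -(card_Syl sylSM) card_Syl_mod.
  rewrite t_def; case: central_index6 => _ _ [] -> n_mod; rewrite dvdn_divisors // !inE => n_div.
    by move: n_div n_mod; do 7?[case/orP]; move/eqP->.
  by move: n_div n_mod; do 3?[case/orP]; move/eqP->.
pose Y := gcore_group 'N_(D / M)(S / M) (D / M).
have nYQ : Y <| D / M by apply: gcore_normal; apply: subsetIl.
suffices Y1 : Y :=: 1.
  have rep := perm_rep_gcore (subsetIl (D / M) 'N(S / M)).
  have := perm_rep_quotient (subxx D) nDM rep; rewrite [gcore _ _]Y1 cosetpre1.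
  by rewrite (setIidPr sMD); apply: perm_rep_leq.
pose K := (coset M @*^-1 Y)%G.
have defY : K / M = Y by rewrite /= cosetpreK.
have nKD : K <| D by rewrite -(quotientGK nMD) cosetpre_normal.
have sMK : M \subset K by apply: sub_cosetpre.
have pt : p \notin (t : nat_pred).
  by rewrite !inE t_def; case: central_index6 => _ _ [] ->.
(* If [K] meets [M'] trivially it centralises [M'], so it lies in [N = M * M'] and equals [M] by the
   modular law. *)
case: (minM'E (normalI nKD nM'D) (subsetIr _ _)) => [tiKM' | defM'].
  have sKN : K \subset N.
    apply: centralizer_quo (normal_sub nKD) _.
    rewrite quotient_cents2 ?(subset_trans (normal_sub nKD) nDM) ?(subset_trans sM'D nDM) //.
    apply: subset_trans (sub1G M); rewrite -tiKM' subsetI commg_subl commg_subr.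
    by rewrite (subset_trans sM'D (normal_norm nKD)) (subset_trans (normal_sub nKD) nDM').
  rewrite -defY -(setIidPr sKN) defN defE -group_modl // setIC tiKM' mulg1.
  by rewrite trivg_quotient.
(* If [M'] lies in [K], then [M' / M] and [S / M] normalise each other and have coprime orders, so
   they commute. This puts [S] in the [p]-group [N], although [t] divides [#|S|]. *)
have sM'nS : M' / M \subset 'N(S / M).
  apply: (@subset_trans _ _ Y); first by rewrite -defY quotientS // -defM' subsetIl.
  by rewrite (subset_trans (gcore_sub _ _)) ?subsetIr.
have sSN : S \subset N.
  apply: centralizer_quo => //; apply/commG1P/trivgP.
  rewrite -(_ : S / M :&: M' / M = 1).
    by rewrite subsetI commg_subl commg_subr sM'nS quotient_norms // (subset_trans sSD).
  apply: coprime_TIg; apply: pnat_coprime (quotient_pgroup M (pHall_pgroup sylS)) _.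
  apply: sub_pgroup (quotient_pgroup M pM') => q /eqnP->; exact: pt.
case/negP: pt; rewrite !inE eq_sym -dvdn_prime2 //.
have t_dvd : t %| #|N|.
  apply: dvdn_trans (cardSg sSN); rewrite (card_Hall sylS) p_part.
  rewrite -[X in X %| _]expn1 dvdn_exp2l // logn_gt0 mem_primes t_pr cardG_gt0.
  exact: dvdn_indexg.
by have [k oN] := p_natP pN; move: t_dvd; rewrite oN Euclid_dvdX // => /andP[].
Qed.


End CentralVersusMinimal.

(** * A faithful orbit with meet-irreducible stabiliser on which [H] is transitive *)

Definition meet_irreducible (gT : finGroupType) (D L : {group gT}) :=
  forall A B : {group gT}, A \subset D -> B \subset D -> A :&: B = L ->
  A :=: L \/ B :=: L.

Section FaithfulTransitive.

Variables (gT : finGroupType) (D L G H : {group gT}).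
Hypotheses (sLD : L \subset D)
  (coreL : forall N : {group gT}, N <| D -> N \subset L -> N :=: 1)
  (irrL : meet_irreducible D L)
  (cGH : H \subset 'C(G)) (defD : G * H = D) (transH : L * H = D).

Let sGD : G \subset D. Proof. by rewrite -defD mulG_subl. Qed.
Let sHD : H \subset D. Proof. by rewrite -defD mulG_subr. Qed.
Let nGD : G <| D.
Proof. by rewrite /normal sGD -defD mul_subG ?normG ?cents_norm. Qed.

(** [L] normalises [G :&: L] and [H] centralises it; as [L * H = D], it is normal in [D]. *)
Let tiGL : G :&: L = 1.
Proof.
apply: (coreL (N := (G :&: L)%G)); last exact: subsetIr.
rewrite /normal subIset ?sGD //= -transH; apply: mul_subG.
  by rewrite normsI ?normG // (subset_trans sLD) ?normal_norm.
by rewrite cents_norm // (centsS (subsetIl G L)).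
Qed.

Lemma semiregular_TI : G :&: L = 1. Proof. exact: tiGL. Qed.

Let normalGD (R : {group gT}) : R <| G -> R <| D.
Proof.
case/andP=> sRG nRG; rewrite /normal (subset_trans sRG) //= -defD mul_subG //.
by rewrite cents_norm // (centsS sRG).
Qed.

Lemma semiregular_dvd_index : #|G| %| #|D : L|.
Proof.
have nGL : L \subset 'N(G) := subset_trans sLD (normal_norm nGD).
rewrite -(@dvdn_pmul2l #|L|) // Lagrange // -TI_cardMg 1?setIC //.
by rewrite -(norm_joinEl nGL) cardSg // join_subG sLD.
Qed.

(** Since [G :&: L = 1], normal subgroups [R] and [S] of [G] that meet trivially satisfy
    [(L <*> R) :&: (L <*> S) = L]; irreducibility of [L] then makes one of them trivial. *)
Lemma perm_rep3_semiregular : #|G| = 6 -> perm_rep G 1 3.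
Proof.
apply: perm_rep3_card6 => R S nRG nSG tiRS.
have joinE (X : {group gT}) : X <| G -> L <*> X = L * X.
  by move/normalGD=> nXD; apply/norm_joinEl/(subset_trans sLD)/normal_norm.
have joinD (X : {group gT}) : X <| G -> L <*> X \subset D.
  by move/normalGD/normal_sub=> sXD; rewrite join_subG sLD.
have joinL (X : {group gT}) : X <| G -> L <*> X = L -> X :=: 1.
  move=> nXG defL; apply: coreL (normalGD nXG) _.
  by rewrite -defL joing_subr.
suffices LRS : (L <*> R) :&: (L <*> S) = L.
  by case: (irrL (joinD _ nRG) (joinD _ nSG) LRS) => /joinL->; [left | | right |].
apply/eqP; rewrite eqEsubset subsetI !joing_subl !andbT !joinE //.
apply/subsetP=> x /setIP[/mulsgP[l r Ll Rr ->] /mulsgP[l' s Ll' Ss eq_x]].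
suffices r1 : r = 1 by rewrite r1 mulg1.
have eq_rs : r * s^-1 = l^-1 * l'.
  by rewrite -{1}(mulKg l r) eq_x -!mulgA mulgV mulg1.
have rs1 : r * s^-1 \in G :&: L.
  have [Gr Gs] := (subsetP (normal_sub nRG) _ Rr, subsetP (normal_sub nSG) _ Ss).
  by rewrite inE {2}eq_rs !groupM ?groupV.
have /eqP eq_r_s : r == s by rewrite eq_mulgV1 -in_set1 -[[set 1]]tiGL.
by apply/set1P; rewrite -[[set 1]]tiRS inE Rr eq_r_s.
Qed.

(** The degree is what remains once [G] has taken its regular representation. The kernel [M] is a
    subgroup of prime order in [T :&: 'Z(G)], central in [D] because [H] centralises [G]. *)
Lemma perm_rep_semiregular (q : nat) (T T' : {group gT}) :
    q.-group G -> #|D : L| <= 9 ->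
    T <| D -> T \subset G -> T :!=: 1 -> T' <| D -> T' \subset H -> T' :!=: 1 ->
    T :&: T' = 1 ->
  exists2 M : {group gT}, M \subset T & perm_rep D M (#|D : L| - #|G|).
Proof.
move=> qG le9 nTD sTG ntT nT'D sT'H ntT' tiTT'.
have nTG : T <| G := normalS sTG sGD nTD.
have /trivgPn[z0 TZz0 ntz0] := meet_center_nil (pgroup_nil qG) nTG ntT.
have [p p_pr p_dvd] : exists2 p, prime p & p %| #[z0].
  by exists (pdiv #[z0]); rewrite ?pdiv_dvd // pdiv_prime // order_gt1.
have [z z0z oz] := Cauchy p_pr p_dvd.
pose M := <[z]>%G.
have sMTZ : M \subset T :&: 'Z(G) by rewrite cycle_subG (subsetP _ z z0z) // cycle_subG.
have sMT : M \subset T := subset_trans sMTZ (subsetIl _ _).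
have sMZ : M \subset 'Z(D).
  rewrite subsetI (subset_trans sMT (normal_sub nTD)) -defD centM subsetI.
  rewrite (subset_trans sMTZ) /=; last by rewrite subIset ?subsetIr ?orbT.
  by rewrite (subset_trans sMT) // (subset_trans sTG) // centsC.
have [M' minM' sM'T'] := minnormal_exists ntT' (normal_norm nT'D).
have [ntM' nM'D] : M' :!=: 1 /\ D \subset 'N(M').
  by case/mingroupP: minM' => /andP[].
have sM'D : M' \subset D := subset_trans sM'T' (normal_sub nT'D).
have tiMM' : M :&: M' = 1 by apply/trivgP; rewrite -tiTT' setISS.
have sMD : M \subset D := subset_trans sMZ (center_sub D).
have cLM : M \subset 'C(L) by rewrite (subset_trans sMZ) // subIset ?centS ?orbT.
have defLM : L <*> M = L * M by apply/norm_joinEr/cents_norm.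
have tiLM : L :&: M = 1.
  by apply/trivgP; rewrite /= setIC -tiGL setSI // (subset_trans sMT).
have oLM : #|L <*> M| = (#|L| * p)%N by rewrite defLM TI_cardMg // -oz.
have sLMM' : L * M \subset L * M'.
  rewrite -defLM -norm_joinEl ?(subset_trans sLD) //.
  (* As [L] has prime index in [L <*> M], failure of the inclusion would make [L] the intersection
     of [L <*> M] and [L <*> M']. *)
  apply: contraR ntM' => not_sub; apply/eqP.
  have defI : L <*> M :&: (L <*> M') = L.
    apply/eqP; rewrite eq_sym eqEcard subsetI !joing_subl /=.
    have sLI : L \subset L <*> M :&: (L <*> M') by rewrite subsetI !joing_subl.
    have dvdI : #|L <*> M :&: (L <*> M') : L| %| p.
      rewrite -(@dvdn_pmul2l #|L|) // Lagrange // -oLM cardSg //.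
      exact: subsetIl.
    have [_ /(_ _ dvdI)/orP[/eqP i1 | /eqP ip]] := primeP p_pr.
      by rewrite -(index1g sLI i1).
    case/negP: not_sub; apply/setIidPl/eqP.
    by rewrite eqEcard subsetIl /= oLM -ip (Lagrange sLI) leqnn.
  case: (irrL (A := (L <*> M)%G) (B := (L <*> M')%G) _ _ defI).
  - by rewrite join_subG sLD.
  - by rewrite join_subG sLD.
  - move=> eqLM; have := oLM; rewrite [L <*> M]eqLM => /eqP.
    by rewrite -{1}(muln1 #|L|) eqn_pmul2l // => /eqP p1; move: p_pr; rewrite -p1.
  by move=> eqLM'; apply: coreL; rewrite /normal ?sM'D // -eqLM' joing_subr.
exists M => //.
have [iL _ p23] := central_index6 sLD coreL p_pr oz sMZ minM' sM'D tiMM' sLMM' le9.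
(* [G] is a [p]-group containing [M], and its order divides 6. *)
suffices ->: #|G| = p.
  by rewrite iL; apply: perm_rep_central sLD coreL p_pr oz sMZ minM' sM'D tiMM' sLMM' le9.
have qp : p = q.
  have /pgroupP qT := pgroupS sMTZ (pgroupS (subset_trans (subsetIl _ _) sTG) qG).
  by apply/eqP; apply: qT => //; rewrite -oz.
have := semiregular_dvd_index; rewrite iL; move: qG; rewrite -qp => qG.
have p_dvdG : p %| #|G| by rewrite -oz cardSg // (subset_trans sMT).
have [k oG] := p_natP qG; rewrite oG in p_dvdG *.
case: k {oG} p_dvdG => [|[|k]]; first by rewrite dvdn1 => /eqP p1; move: p_pr; rewrite p1.
  by rewrite expn1.
by case: p23 => -> _ /(dvdn_trans (dvdn_exp2l _ (isT : 2 <= k.+2))).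
Qed.

End FaithfulTransitive.

(** * Replacing one orbit of a direct product *)

Lemma prime_power_le9 n : 0 < n <= 9 -> n != 6 -> exists2 q, prime q & q.-nat n.
Proof.
case: n => [|[|[|[|[|[|[|[|[|[|n]]]]]]]]]] // _ _.
- by exists 2.
- by exists 2.
- by exists 3.
- by exists 2.
- by exists 5.
- by exists 7.
- by exists 2.
- by exists 3.
Qed.

(* [K] stands for the kernel of the action on the orbits that are not being replaced. *)
Definition split_rep (gT : finGroupType) (G H K : {group gT}) (n : nat) :=
  exists (A B : {group gT}) (a b : nat),
    [/\ perm_rep G A a, perm_rep H B b, a + b <= n & K :&: (A * B) = 1].

(** The proof exchanges the two factors, so it reads its hypothesis as [split_rep H G K n]; as
    written, hypothesis and conclusion are the same proposition. *)
Lemma split_rep_sym (gT : finGroupType) (G H K : {group gT}) n :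
  H \subset 'C(G) -> split_rep H G K n -> split_rep G H K n.
Proof.
move=> cGH [B [A [b [a [rB rA le_n tiK]]]]].
exists A, B, a, b; split=> //; first by rewrite addnC.
rewrite -(@normC _ B A) // cents_norm // (subset_trans (normal_sub (perm_rep_normal rB))) //.
by rewrite (subset_trans cGH) // centS // (normal_sub (perm_rep_normal rA)).
Qed.

Lemma split_rep_leq (gT : finGroupType) (G H K : {group gT}) m n :
  m <= n -> split_rep G H K m -> split_rep G H K n.
Proof.
move=> le_mn [A [B [a [b [rA rB le_m tiK]]]]].
by exists A, B, a, b; split=> //; apply: leq_trans le_mn.
Qed.

Section DirectProduct.

Variables (gT : finGroupType) (D G H : {group gT}).
Hypothesis dpD : G \x H = D.

Let defD : G * H = D. Proof. by case/dprodP: dpD. Qed.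
Let cGH : H \subset 'C(G). Proof. by case/dprodP: dpD. Qed.
Let tiGH : G :&: H = 1. Proof. by case/dprodP: dpD. Qed.
Let sGD : G \subset D. Proof. by rewrite -defD mulG_subl. Qed.
Let sHD : H \subset D. Proof. by rewrite -defD mulG_subr. Qed.

Let normalGD (A : {group gT}) : A <| G -> A <| D.
Proof.
case/andP=> sAG nAG; rewrite /normal (subset_trans sAG) //= -defD mul_subG //.
by rewrite cents_norm // (centsS sAG).
Qed.

Let normalHD (B : {group gT}) : B <| H -> B <| D.
Proof.
case/andP=> sBH nBH; rewrite /normal (subset_trans sBH) //= -defD mul_subG //.
by rewrite cents_norm // centsC (subset_trans sBH).
Qed.

Let mul_inj x y x' y' :
  x \in G -> y \in H -> x' \in G -> y' \in H -> x * y = x' * y' -> x = x' /\ y = y'.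
Proof.
move=> Gx Hy Gx' Hy' eq_xy; suffices eqx : x = x'.
  by split=> //; apply: (mulgI x); rewrite eq_xy eqx.
apply/esym/eqP; rewrite eq_mulVg1 -in_set1 -[[set 1]]tiGH inE groupM ?groupV //=.
rewrite (_ : x'^-1 * x = y' * y^-1) ?groupM ?groupV //.
by rewrite -(mulgK y x) eq_xy mulgA mulKg.
Qed.

Let mulE (A B : {group gT}) : A \subset G -> B \subset H -> A <*> B = A * B.
Proof.
move=> sAG sBH; apply/norm_joinEr/cents_norm.
by rewrite (subset_trans sBH) // (subset_trans cGH) // centS.
Qed.

Let normal_mul (A B : {group gT}) : A <| G -> B <| H -> A <*> B <| D.
Proof. by move=> nAG nBH; apply: normalY; [apply: normalGD | apply: normalHD]. Qed.

(** The orbits with kernel [Y] are replaced first, against [K :&: X]; the new kernel [A2 * B2] then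
    takes the place of [Y] while those with kernel [X] are replaced. *)
Lemma split_repI (X : {group gT}) (Y : {set gT}) m n :
    X <| D ->
    (forall K : {group gT}, K <| D -> K :&: X = 1 -> split_rep G H K m) ->
    (forall K : {group gT}, K <| D -> K :&: Y = 1 -> split_rep G H K n) ->
  forall K : {group gT}, K <| D -> K :&: (X :&: Y) = 1 -> split_rep G H K (m + n).
Proof.
move=> nXD splX splY K nKD tiK.
have [|A2 [B2 [a2 [b2 [rA2 rB2 le2 ti2]]]]] := splY _ (normalI nKD nXD).
  by rewrite -setIA.
have [nA2 nB2] := (perm_rep_normal rA2, perm_rep_normal rB2).
have sA2G := normal_sub nA2; have sB2H := normal_sub nB2.
have [|A1 [B1 [a1 [b1 [rA1 rB1 le1 ti1]]]]] :=
  splX _ (normalI nKD (normal_mul nA2 nB2)).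
  by rewrite /= mulE // setIAC.
exists (A1 :&: A2)%G, (B1 :&: B2)%G, (a1 + a2)%N, (b1 + b2)%N; split.
- exact: perm_repI.
- exact: perm_repI.
- by rewrite addnACA leq_add.
have sAG : A1 :&: A2 \subset G by rewrite subIset ?sA2G ?orbT.
have sBH : B1 :&: B2 \subset H by rewrite subIset ?sB2H ?orbT.
rewrite -mulE //; apply/trivgP; rewrite -ti1 /= !mulE // -setIA setIS //.
by rewrite subsetI !mulgSS ?subsetIl ?subsetIr.
Qed.

Lemma split_rep_transitive (L K : {group gT}) :
    L \subset D -> meet_irreducible D L -> L * H = D -> #|D : L| <= 9 ->
  K <| D -> K :&: gcore L D = 1 -> split_rep G H K #|D : L|.
Proof.
move=> sLD irrL transH le9 nKD; set C := gcore_group L D => tiKC.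
have nCD : C <| D := gcore_normal sLD.
have sCL : C \subset L := gcore_sub L D.
have nCsub (A : {set gT}) : A \subset D -> A \subset 'N(C).
  by move=> sAD; apply: subset_trans sAD (normal_norm nCD).
have repC (A : {group gT}) : A \subset D -> perm_rep A (A :&: C) #|D : L|.
  by move=> sAD; apply: perm_rep_sub sAD (perm_rep_gcore sLD).
have nIC (A : {group gT}) : A \subset D -> A :&: C <| A.
  by move=> sAD; apply: normalGI nCD.
pose T := (K :&: (G <*> (H :&: C)))%G.
pose T' := (K :&: ((G :&: C) <*> H))%G.
(* If [T] is trivial, the action of [H] alone on this orbit suffices; if [T'] is, that of [G]
   alone. *)
have [T1 | ntT] := eqVneq (T : {set gT}) 1.
  exists G, (H :&: C)%G, 0, #|D : L|; split=> //; try exact: perm_rep_triv.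
  - exact: repC.
  by rewrite -mulE ?subsetIl.
have [T'1 | ntT'] := eqVneq (T' : {set gT}) 1.
  exists (G :&: C)%G, H, #|D : L|, 0; split=> //; try exact: perm_rep_triv.
  - exact: repC.
  - by rewrite addn0.
  by rewrite -mulE ?subsetIl.
have coreLq (N : {group coset_of C}) : N <| D / C -> N \subset L / C -> N :=: 1.
  move=> nND sNL; suffices preN : coset C @*^-1 N = C by rewrite -(cosetpreK N) preN trivg_quotient.
  apply/eqP; rewrite eqEsubset sub_cosetpre andbT gcore_max //.
    by rewrite -(quotientGK (normalS sCL sLD nCD)) cosetpreSK.
  by rewrite -{1}(quotientGK nCD) normal_norm // cosetpre_normal.
have irrLq : meet_irreducible (D / C) (L / C).
  move=> A B sA sB defI.
  have preD (X : {group coset_of C}) : X \subset D / C -> coset C @*^-1 X \subset D.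
    by move=> sX; rewrite -(quotientGK nCD) cosetpreSK.
  have defL : coset C @*^-1 A :&: coset C @*^-1 B = L.
    by rewrite -morphpreI defI quotientGK // (normalS sCL sLD nCD).
  by case: (irrL _ _ (preD A sA) (preD B sB) defL) => /= eqL; [left | right];
    rewrite -[LHS]cosetpreK eqL.
have iLq : #|D / C : L / C| = #|D : L|.
  by rewrite index_quotient_eq ?nCsub // (subset_trans (subsetIr _ _)).
have cGHq : H / C \subset 'C(G / C) by apply: quotient_cents.
have defDq : G / C * (H / C) = D / C by rewrite -quotientMl ?nCsub ?defD.
have transHq : L / C * (H / C) = D / C by rewrite -quotientMl ?nCsub ?transH.
have sLDq : L / C \subset D / C := quotientS C sLD.
have tiC (x y : gT) : x \in K -> y \in K -> coset C x = coset C y -> x = y.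
  move=> Kx Ky eq_xy; have [nCx nCy] : x \in 'N(C) /\ y \in 'N(C).
    by split; apply: (subsetP (nCsub K (normal_sub nKD))).
  apply/eqP; rewrite eq_mulgV1 -in_set1 -[[set 1]]tiKC inE groupM ?groupV //=.
  by rewrite coset_idr ?groupM ?groupV // morphM ?groupV // morphV //= eq_xy mulgV.
have rep_pre (A : {group gT}) (X : {group coset_of C}) n :
    A \subset D -> A / C \subset X -> perm_rep X 1 n -> perm_rep A (A :&: C) n.
  move=> sAD sAX rX; have := perm_rep_sub sAX rX; rewrite (setIidPr _) ?sub1G // => rA.
  by have := perm_rep_quotient (subxx A) (nCsub A sAD) rA; rewrite cosetpre1.
have tiGHC : K :&: ((G :&: C) * (H :&: C)) = 1.
  rewrite -mulE ?subsetIl //; apply/trivgP; rewrite -tiKC setIS //.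
  by rewrite join_subG !subsetIr.
have le_k9 : #|G / C| <= #|D : L|.
  rewrite dvdn_leq // -iLq.
  exact: semiregular_dvd_index sLDq coreLq cGHq defDq transHq.
(* When [#|G / C| = 6], the degree is a multiple of 6 below 10, so [G / C] is regular. Being
   transitive, it makes [H / C] semiregular too, and the roles become symmetric. *)
have [k6 | nk6] := eqVneq #|G / C| 6.
  have i6 : #|D : L| = 6.
    have := semiregular_dvd_index sLDq coreLq cGHq defDq transHq.
    rewrite k6 iLq => /dvdnP[[|[|j]] def_i]; rewrite ?def_i //.
      by have := indexg_gt0 D L; rewrite def_i.
    by move: le9; rewrite def_i.
  have cHGq : G / C \subset 'C(H / C) by rewrite centsC.
  have defDq' : H / C * (G / C) = D / C by rewrite -defDq normC // cents_norm.
  have tiLGq : L / C :&: (G / C) = 1.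
    by rewrite setIC; apply: semiregular_TI sLDq coreLq cGHq defDq transHq.
  have oDq : #|D / C| = (#|L / C| * 6)%N by rewrite -(Lagrange sLDq) iLq i6.
  have transGq : L / C * (G / C) = D / C.
    apply/eqP; rewrite eqEcard mul_subG ?quotientS //= TI_cardMg //.
    by rewrite [#|G / C|]k6 [#|D / C|]oDq.
  have oHq : #|H / C| = 6.
    have tiLHq : L / C :&: (H / C) = 1.
      by rewrite setIC; apply: semiregular_TI sLDq coreLq cHGq defDq' transGq.
    apply/eqP; rewrite -(@eqn_pmul2l #|L / C|) // -oDq -transHq.
    by rewrite TI_cardMg.
  exists (G :&: C)%G, (H :&: C)%G, 3, 3; split=> //; rewrite ?i6 //.
    apply: rep_pre (subxx _) _ => //.
    exact: perm_rep3_semiregular sLDq coreLq irrLq cGHq defDq transHq k6.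
  apply: rep_pre (subxx _) _ => //.
  exact: perm_rep3_semiregular sLDq coreLq irrLq cHGq defDq' transGq oHq.
have [q _ qG] : exists2 q, prime q & q.-group (G / C).
  by apply: prime_power_le9; rewrite ?cardG_gt0 ?(leq_trans le_k9).
have nTD : T <| D by rewrite normalI // normal_mul // nIC.
have nT'D : T' <| D by rewrite normalI // normal_mul // nIC.
have sTG : T / C \subset G / C.
  rewrite (subset_trans (quotientS C (subsetIr _ _))) // quotientY ?nCsub ?subIset ?sHD //.
  by rewrite join_subG subxx (subset_trans (quotientS C (subsetIr _ _))) ?trivg_quotient ?sub1G.
have sT'H : T' / C \subset H / C.
  rewrite (subset_trans (quotientS C (subsetIr _ _))) // quotientY ?nCsub ?subIset ?sGD //.
  by rewrite join_subG subxx (subset_trans (quotientS C (subsetIr _ _))) ?trivg_quotient ?sub1G.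
have ntq (X : {group gT}) : X \subset K -> X :!=: 1 -> X / C != 1.
  move=> sXK; apply: contra => /eqP X1; rewrite -subG1 -tiKC subsetI sXK.
  have nCX : X \subset 'N(C) by rewrite nCsub // (subset_trans sXK) ?normal_sub.
  by rewrite -[gcore L D]/(gval C) -quotient_sub1 // X1 sub1G.
(* A common element lifts to a single [x] of [K]; comparing its two factorisations in [G * H] puts
   both factors in [C]. *)
have tiTT' : T / C :&: (T' / C) = 1.
  apply/trivgP/subsetP=> xb /setIP[/morphimP[x nCx Tx ->] /morphimP[y nCy T'y eq_xy]].
  have [[Kx Gx] [Ky Hy]] := (setIP Tx, setIP T'y).
  have eqxy := tiC x y Kx Ky eq_xy; rewrite -{y}eqxy in Hy {T'y nCy Ky eq_xy}.
  rewrite inE; apply/eqP/coset_id.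
  move: Gx Hy; rewrite /= !mulE ?subsetIl // => /mulsgP[g c Gg /setIP[Hc Cc] def_x].
  case/mulsgP=> c' h /setIP[Gc' Cc'] Hh def_x'.
  have [/= eq_g eq_c] : g = c' /\ c = h.
    by apply: mul_inj; rewrite // -def_x.
  by rewrite def_x eq_g groupM.
have le9q : #|D / C : L / C| <= 9 by rewrite iLq.
have [Mq sMT] := perm_rep_semiregular sLDq coreLq irrLq cGHq defDq transHq qG le9q
  (quotient_normal C nTD) sTG (ntq T (subsetIl _ _) ntT)
  (quotient_normal C nT'D) sT'H (ntq T' (subsetIl _ _) ntT') tiTT'.
rewrite iLq => repM.
have repA : perm_rep G (G :&: C) #|G / C|.
  apply: rep_pre (subxx _) _ => //.
  have := perm_rep_gcore (sub1G (G / C)); rewrite indexg1.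
  by rewrite (trivgP (gcore_sub _ _)).
have repB := perm_rep_quotient sHD (normal_norm nCD) repM.
(* [G / C] acts regularly, and [H] through [D / C] modulo [Mq]. *)
exists (G :&: C)%G, (H :&: coset C @*^-1 Mq)%G, #|G / C|, (#|D : L| - #|G / C|)%N.
split=> //; first by rewrite subnKC.
rewrite -mulE ?subsetIl //; apply/trivgP/subsetP=> x /setIP[Kx].
rewrite /= mulE ?subsetIl // => /mulsgP[a b /setIP[Ga Ca] /setIP[Hb /morphpreP[nCb Mb]] def_x].
(* Modulo [C], [x] is [b], which lies in [Mq] and so in [T / C]. Hence [x] is in [T], its
   [H]-component [b] is in [C], and [x] lies in [K :&: C]. *)
have eq_xb : coset C x = coset C b.
  by rewrite def_x mkerl ?ker_coset.
have /morphimP[t nCt Tt eq_bt] := subsetP sMT _ Mb.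
have [Kt] := setIP Tt; rewrite /= mulE ?subsetIl // => /mulsgP[g c Gg /setIP[Hc Cc] def_t].
have eq_xt : x = t by apply: tiC; rewrite // eq_xb.
have [_ eq_bc] : a = g /\ b = c by apply: mul_inj; rewrite // -def_x eq_xt.
by rewrite -tiKC inE Kx def_x groupM // eq_bc.
Qed.

(** A normal subgroup that is not transitive on [D / L] has orbits of at most half the degree, so
    one orbit of [G] and one of [H] fit together. *)
Lemma split_rep_intransitive (L K : {group gT}) :
    L \subset D -> L * G != D -> L * H != D -> K :&: gcore L D = 1 ->
  split_rep G H K #|D : L|.
Proof.
move=> sLD ntG ntH tiKC.
have double_index (X : {group gT}) : X <| D -> L * X != D -> (#|X : X :&: L|).*2 <= #|D : L|.
  move=> nXD ntX; have nXL : L \subset 'N(X) := subset_trans sLD (normal_norm nXD).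
  have sLXD : L <*> X \subset D by rewrite join_subG sLD normal_sub.
  rewrite -(Lagrange_index sLXD (joing_subl _ _)) indexgI -muln2 mulnC.
  have ->: #|L <*> X : L| = #|X : L|.
    apply/eqP; rewrite -(eqn_pmul2l (cardG_gt0 L)) (Lagrange (joing_subl L X)).
    by rewrite /= (norm_joinEl nXL) mulnC LagrangeMr (normC nXL).
  rewrite leq_mul // indexg_gt1; apply: contra ntX => sDLX.
  by rewrite -norm_joinEl // eqEsubset sLXD.
have nGD := normalGD (normal_refl G); have nHD := normalHD (normal_refl H).
exists (gcore_group (G :&: L) G), (gcore_group (H :&: L) H), #|G : G :&: L|, #|H : H :&: L|.
split; try exact/perm_rep_gcore/subsetIl.
  by rewrite -leq_double doubleD -[X in _ <= X]addnn leq_add ?double_index.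
have [nA nB] := (gcore_normal (subsetIl G L), gcore_normal (subsetIl H L)).
rewrite -mulE ?normal_sub //; apply/trivgP; rewrite -tiKC setIS // gcore_max //.
  rewrite join_subG !(subset_trans (gcore_sub _ _)) ?subsetIr //.
by rewrite normal_norm // normal_mul.
Qed.

End DirectProduct.

(** * Reduction to meet-irreducible stabilisers, and all orbits in turn *)

(** Induction on the index: if [L] is the intersection of two larger subgroups, each has at most
    half the index, and their cores intersect inside the core of [L]. *)
Lemma split_rep_index (gT : finGroupType) (D G H L K : {group gT}) :
    G \x H = D -> L \subset D -> #|D : L| <= 9 -> K <| D -> K :&: gcore L D = 1 ->
  split_rep G H K #|D : L|.
Proof.
move=> dpD; elim: {L}_.+1 {-2}L (ltnSn #|D : L|) K => // n IHn L le_n K sLD le9 nKD tiKL.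
have [|irr] := boolP [exists A : {group gT}, [exists B : {group gT},
    [&& A \subset D, B \subset D, A :&: B == L, A != L & B != L]]].
  case/existsP=> A /existsP[B /and5P[sAD sBD /eqP defL neA neB]].
  have double (X : {group gT}) : X \subset D -> L \subset X -> X != L ->
      0 < #|D : X| /\ (#|D : X|).*2 <= #|D : L|.
    move=> sXD sLX neX; rewrite indexg_gt0 -(Lagrange_index sXD sLX) -muln2 leq_mul //.
    by rewrite indexg_gt1; apply: contra neX => sXL; rewrite -val_eqE eqEsubset sXL.
  have [sLA sLB] : L \subset A /\ L \subset B by rewrite -defL subsetIl subsetIr.
  have [[A0 A2] [B0 B2]] := (double A sAD sLA neA, double B sBD sLB neB).
  have smaller (X : {group gT}) : 0 < #|D : X| -> (#|D : X|).*2 <= #|D : L| ->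
      #|D : X| < n /\ #|D : X| <= 9.
    by move: #|D : X| #|D : L| le_n le9 => i j; clear; lia.
  have [[A3 A4] [B3 B4]] := (smaller A A0 A2, smaller B B0 B2).
  have le_AB : #|D : A| + #|D : B| <= #|D : L|.
    by rewrite -leq_double doubleD -[X in _ <= X]addnn leq_add.
  apply: split_rep_leq le_AB _.
  apply: (split_repI dpD (gcore_normal sAD) (Y := gcore B D)) nKD _.
  - by move=> K' nK'D; apply: IHn.
  - by move=> K' nK'D; apply: IHn.
  apply/trivgP; rewrite -tiKL setIS // gcore_max //.
    by rewrite -defL setISS ?gcore_sub.
  by rewrite normsI ?gcore_norm.
move: irr; rewrite negb_exists => /forallP irr.
have irrL : meet_irreducible D L.
  move=> A B sAD sBD defL; have := irr A; rewrite negb_exists => /forallP/(_ B).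
  rewrite sAD sBD -[_ == L]val_eqE /= defL eqxx /= negb_and !negbK.
  by case/orP=> /eqP->; [left | right].
have [transH | ntH] := eqVneq (L * H) D.
  exact: (split_rep_transitive dpD).
have [transG | ntG] := eqVneq (L * G) D; last exact: (split_rep_intransitive dpD).
case/dprodP: (dpD) => _ _ cGH _; apply: split_rep_sym => //.
by apply: split_rep_transitive; rewrite // dprodC.
Qed.

Lemma split_rep_seq (gT : finGroupType) (D G H : {group gT}) (s : seq {group gT}) :
    G \x H = D -> all (fun L : {group gT} => L \subset D) s ->
    \sum_(L <- s) #|D : L| <= 9 ->
  forall K : {group gT}, K <| D -> K :&: \bigcap_(L <- s) gcore L D = 1 ->
  split_rep G H K (\sum_(L <- s) #|D : L|).
Proof.
move=> dpD; elim: s => [|L s IHs] /=.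
  move=> _ _ K _; rewrite !big_nil setIT => K1.
  exists G, H, 0, 0; split=> //; try exact: perm_rep_triv.
  by case/dprodP: dpD => _ -> _ _; rewrite K1; apply/setIidPl/sub1G.
case/andP=> sLD sD; rewrite !big_cons => le9.
apply: (split_repI dpD (gcore_normal sLD)).
  move=> K nKD; apply: split_rep_index => //; apply: leq_trans le9; exact: leq_addr.
by apply: IHs => //; apply: leq_trans le9; apply: leq_addl.
Qed.

(* One point stabiliser for each orbit. *)
Lemma perm_rep_stabilizers (gT : finGroupType) (D : {group gT}) n :
  perm_rep D 1 n ->
  exists s : seq {group gT}, [/\ all (fun L : {group gT} => L \subset D) s,
    \sum_(L <- s) #|D : L| <= n & D :&: \bigcap_(L <- s) gcore L D = 1].
Proof.
move=> [T [f [kerf leT]]]; pose to := ('P \o f)%act.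
have sDto : D \subset f @*^-1 setT by rewrite -sub_morphim_pre // subsetT.
have actsT : [acts D, on setT | to].
  by apply/subsetP=> x Dx; rewrite !inE Dx; apply/subsetP=> y; rewrite !inE.
pose X := orbit_transversal to D setT.
have [_ _ injX exX] := orbit_transversalP actsT.
exists [seq 'C_D[x | to]%G | x <- enum X]; split.
- by apply/allP=> L /mapP[x _ ->]; apply: subsetIl.
- rewrite big_map big_enum /= (leq_trans _ leT) //.
  rewrite -cardsT -(acts_sum_card_orbit actsT).
  rewrite (eq_bigr (fun x => #|orbit to D x|)); last first.
    by move=> x _; rewrite card_orbit_in.
  have ->: [set orbit to D x | x in setT] = [set orbit to D x | x in X].
    apply/eqP; rewrite eq_sym eqEsubset imsetS ?subsetT //=.
    apply/subsetP=> _ /imsetP[x _ ->]; have [b Db Xxb] := exX x (in_setT x).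
    apply/imsetP; exists (to x b) => //.
    by apply/esym/orbit_in_eqP; rewrite // mem_orbit.
  have orb_inj : {in X &, injective (orbit to D)}.
    move=> x y Xx Xy /= eq_orb; apply/eqP.
    by rewrite -injX // eq_orb orbit_refl.
  by rewrite (big_imset _ orb_inj).
rewrite big_map big_enum /=; apply/eqP; rewrite eqEsubset sub1set inE group1.
apply/andP; split; last by apply/bigcapP=> x _; apply: group1.
apply: (@subset_trans _ _ ('ker f)); last by rewrite kerf.
apply/subsetP=> y /setIP[Dy /bigcapP fix_y].
rewrite !inE Dy /=; apply/eqP/permP=> u; rewrite perm1.
(* [to u b] represents the orbit of [u]; the core of its stabiliser lies in every conjugate, in
   particular in the stabiliser of [u]. *)
have [b Db Xub] := exX u (in_setT u).
have: y \in gcore 'C_D[to u b | to] D.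
  exact: fix_y.
move/bigcapP/(_ _ (groupVr Db)); rewrite mem_conjg invgK => /setIP[_ /astab_act/(_ (set11 _))].
rewrite /= /comp_act /= /aperm morphJ // -permM -conjgC permM.
exact: perm_inj.
Qed.

(** * Minimal degrees of direct products *)

(** All orbits are replaced, so the construction starts with [K = D]; then [D :&: (A * B) = 1] makes
    both new actions faithful. *)
Lemma mu_dprod_leq (gT : finGroupType) (D G H : {group gT}) :
  G \x H = D -> mu D <= 9 -> mu G + mu H <= mu D.
Proof.
move=> dpD le9; have [s [sD le_s tis]] := perm_rep_stabilizers (mu_perm_rep D).
have [A [B [a [b [rA rB le_ab tiAB]]]]] :=
  split_rep_seq dpD sD (leq_trans le_s le9) (normal_refl D) tis.
have [_ defD _ _] := dprodP dpD.
have [sAG sBH] := (normal_sub (perm_rep_normal rA), normal_sub (perm_rep_normal rB)).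
have sABD : A * B \subset D by rewrite -defD mulgSS.
have tAB : A * B = 1 by rewrite -tiAB (setIidPr sABD).
have A1 : A :=: 1 by apply/trivgP; rewrite -tAB mulG_subl.
have B1 : B :=: 1 by apply/trivgP; rewrite -tAB mulG_subr.
rewrite A1 B1 in rA rB; apply: leq_trans le_s; apply: leq_trans le_ab.
by rewrite leq_add // perm_rep_mu.
Qed.

Lemma mu_isog (aT rT : finGroupType) (G : {group aT}) (R : {group rT}) :
  G \isog R -> mu G <= mu R.
Proof.
case/isogP=> f injf defR; apply: perm_rep_mu.
have sR : f @* G \subset R by rewrite defR.
have := perm_rep_morphpre (subxx G) sR (mu_perm_rep R).
by rewrite -/('ker f) (trivgP injf) (setIidPr (sub1G G)).
Qed.

Lemma mu_setX_leq (gT hT : finGroupType) (G : {group gT}) (H : {group hT}) :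
  mu (setX_group G H) <= mu G + mu H.
Proof.
apply: perm_rep_mu; pose D := setX_group G H.
have fstD : fst @* D \subset G by rewrite morphim_fstX.
have sndD : snd @* D \subset H by rewrite morphim_sndX.
have := perm_repI (perm_rep_morphpre (subsetT D) fstD (mu_perm_rep G))
  (perm_rep_morphpre (subsetT D) sndD (mu_perm_rep H)).
set N := _ :&: _; suffices -> : N = 1 by [].
apply/trivgP/subsetP=> -[x y] /setIP[/setIP[_ /morphpreP[_ /set1P /= ->]]].
by case/setIP=> _ /morphpreP[_ /set1P /= ->]; apply: set11.
Qed.

Theorem theorem3p11 (gT hT : finGroupType) (G : {group gT}) (H : {group hT}) :
  mu (setX_group G H) <= 9 ->
  mu (setX_group G H) = mu G + mu H.
Proof.
move=> le9; apply/eqP; rewrite eqn_leq mu_setX_leq /=.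
have dpX : setX_group G 1 \x setX_group 1 H = setX_group G H by apply: setX_dprod.
apply: leq_trans (mu_dprod_leq dpX le9).
by rewrite leq_add // mu_isog ?isog_setX1 ?isog_set1X.
Qed.
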